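(* Let $K$ be a field and let $I\subset S=K[x_1,\ldots,x_n]$ be a monomial ideal generated in a single degree whose linear relation graph $\Gamma$ has $r$ vertices and $s$ connected components. Then $$\operatorname{depth} S/I^t\le n-t-1\quad\text{for } t=1,\ldots,r-s.$$
   Context: For a monomial ideal $I$, $G(I)=\{u_1,\ldots,u_m\}$ denotes its unique minimal set of monomial generators. The linear relation graph $\Gamma$ of $I$ is the (simple) graph with edge set $$E(\Gamma)=\{\{i,j\}: i\ne j \text{ and there exist } u_k,u_l\in G(I) \text{ such that } x_iu_k=x_ju_l\}$$ and vertex set $V(\Gamma)=\bigcup_{\{i,j\}\in E(\Gamma)}\{i,j\}$. *)

(* Defs.v *)
From HB Require Import structures.
From mathcomp Require Import all_boot all_order all_algebra.
From mathcomp Require Import boolp classical_sets.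
From mathcomp Require Import mpoly.

Set Implicit Arguments.
Unset Strict Implicit.
Unset Printing Implicit Defensive.

Import GRing.Theory.
Local Open Scope classical_set_scope.
Local Open Scope ring_scope.

Section Ideals.
Variable R : comNzRingType.
Implicit Types (A I : set R) (a x y : R).

Definition is_ideal I : Prop :=
  [/\ I 0, forall x y, I x -> I y -> I (x + y) & forall a x, I x -> I (a * x)].

Definition ideal_gen A : set R := smallest is_ideal A.

Definition ideal_pow I (t : nat) : set R :=
  ideal_gen [set x | exists2 f : 'I_t -> R,
                       forall k, I (f k) & x = \prod_(k < t) f k].

Lemma ideal_genP A : is_ideal (ideal_gen A).
Proof.
split.
- by move=> I [[I0 _ _] _].
- by move=> x y Ax Ay I IA; case: (IA) => -[_ ID _] _; apply: ID; [exact: Ax|exact: Ay].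
- by move=> a x Ax I IA; case: (IA) => -[_ _ IM] _; apply: IM; exact: Ax.
Qed.

Definition ideal_pred A : {pred R} := fun x => `[< ideal_gen A x >].

Lemma ideal_predP A x : reflect (ideal_gen A x) (x \in ideal_pred A).
Proof. exact: asboolP. Qed.

Lemma ideal_pred_zmod_closed A : zmod_closed (ideal_pred A).
Proof.
have [I0 ID IM] := ideal_genP A; split; first exact/ideal_predP.
move=> x y /ideal_predP Ix /ideal_predP Iy; apply/ideal_predP.
by apply: ID => //; rewrite -mulN1r; apply: IM.
Qed.

HB.instance Definition _ A :=
  GRing.isZmodClosed.Build R (ideal_pred A) (ideal_pred_zmod_closed A).

End Ideals.

(* The R-module R/(A), where (A) is the ideal generated by A; it is R/A when A
   is already an ideal. The additive quotient of ring_quotient is used because,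
   unlike {ideal_quot _}, it does not require the ideal to be proper. *)
Section CyclicModule.
Variables (R : comNzRingType) (A : set R).
Import Quotient.
Local Open Scope quotient_scope.

Definition cyclic_mod : Type := {quot ideal_pred A}.

HB.instance Definition _ := GRing.Zmodule.on cyclic_mod.
HB.instance Definition _ := EqQuotient.on cyclic_mod.

Definition cyclic_scale (a : R) (v : cyclic_mod) : cyclic_mod :=
  \pi_cyclic_mod (a * repr v).

Lemma pi_cyclic_eq (x y : R) :
  \pi_cyclic_mod x = \pi_cyclic_mod y <-> ideal_gen A (x - y).
Proof.
split=> [/eqP|/ideal_predP Axy].
  by rewrite -[X in is_true X](idealrBE (ideal_pred A)) => /ideal_predP.
by apply/eqP; rewrite -[X in is_true X](idealrBE (ideal_pred A)).
Qed.

Lemma cyclic_scale_pi (a x : R) :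
  cyclic_scale a (\pi_cyclic_mod x) = \pi_cyclic_mod (a * x).
Proof.
apply/pi_cyclic_eq; rewrite -mulrBr.
have [_ _ IM] := ideal_genP A; apply: IM.
by apply/pi_cyclic_eq; rewrite reprK.
Qed.

Lemma pi_cyclicD (x y : R) :
  \pi_cyclic_mod (x + y) = \pi_cyclic_mod x + \pi_cyclic_mod y.
Proof. exact: (@pi_add R (ideal_pred A) x y). Qed.

Lemma cyclic_scaleA a b v :
  cyclic_scale a (cyclic_scale b v) = cyclic_scale (a * b) v.
Proof.
rewrite -[v]reprK (cyclic_scale_pi b) (cyclic_scale_pi a).
by rewrite (cyclic_scale_pi (a * b)) mulrA.
Qed.

Lemma cyclic_scale1 : left_id 1 cyclic_scale.
Proof. by move=> v; rewrite -[v]reprK !cyclic_scale_pi mul1r. Qed.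

Lemma cyclic_scaleDr : right_distributive cyclic_scale +%R.
Proof.
move=> a v w; rewrite -[v]reprK -[w]reprK.
by rewrite -pi_cyclicD !(cyclic_scale_pi a) mulrDr pi_cyclicD.
Qed.

Lemma cyclic_scaleDl v : {morph cyclic_scale^~ v : a b / a + b}.
Proof.
move=> a b; rewrite -[v]reprK (cyclic_scale_pi (a + b)) (cyclic_scale_pi a).
by rewrite (cyclic_scale_pi b) mulrDl pi_cyclicD.
Qed.

HB.instance Definition _ := GRing.Zmodule_isLmodule.Build R cyclic_mod
  cyclic_scaleA cyclic_scale1 cyclic_scaleDr cyclic_scaleDl.

End CyclicModule.

Section Depth.
Variables (R : comNzRingType) (M : lmodType R).

(* The submodule (f_0, ..., f_(k-1))M. *)
Definition seq_submod (f : seq R) : set M :=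
  [set v | exists w : nat -> M, v = \sum_(0 <= i < size f) f`_i *: w i].

Definition regular_seq (f : seq R) : Prop :=
  (forall i : nat, (i < size f)%N ->
     forall v : M, seq_submod (take i f) (f`_i *: v) ->
       seq_submod (take i f) v)
  /\ seq_submod f <> setT.

(* d is the depth of M with respect to m: the maximal length of an M-regular
   sequence contained in m. *)
Definition is_depth (m : set R) (d : nat) : Prop :=
  (exists2 f : seq R, {in f, forall x, m x} & regular_seq f /\ size f = d)
  /\ (forall f : seq R, {in f, forall x, m x} -> regular_seq f ->
        (size f <= d)%N).

End Depth.

Section MonomialIdeals.
Variables (K : fieldType) (n : nat).
Local Notation S := {mpoly K[n]}.
Implicit Types (I : set S) (G H : set 'X_{1..n}).

(* For a graded S-module M (such as S/I^t), depth M is is_depth M max_ideal. *)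
Definition max_ideal : set S := ideal_gen [set 'X_i | i in [set: 'I_n]].

(* The monomial ideal generated by the monomials with exponents in G. *)
Definition mon_ideal G : set S := ideal_gen [set 'X_[u] | u in G].

Definition is_monomial_ideal I : Prop := exists G, I = mon_ideal G.

(* G is the set of exponents of G(I), encoding monomials by their exponents. *)
Definition min_mon_gens I G : Prop :=
  I = mon_ideal G /\ forall H, H `<=` G -> I = mon_ideal H -> H = G.

End MonomialIdeals.

Section LinearRelationGraph.
Variables (n : nat) (G : set 'X_{1..n}).

Definition lin_edge : rel 'I_n := fun i j =>
  (i != j) && `[< exists u v, [/\ G u, G v & (U_(i) + u = U_(j) + v)%MM] >].

Definition lin_vertices : {set 'I_n} :=
  [set i | [exists j, lin_edge i j]]%SET.

Lemma lin_edge_sym : ssrbool.symmetric lin_edge.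
Proof.
by move=> i j; rewrite /lin_edge eq_sym; congr (_ && _); apply/asboolP/asboolP;
  case=> u [v [Gu Gv uv]]; exists v, u.
Qed.

Lemma lin_edge_connect_sym : connect_sym lin_edge.
Proof. exact: sym_connect_sym lin_edge_sym. Qed.

Lemma lin_vertices_closed : fingraph.closed lin_edge lin_vertices.
Proof.
move=> i j eij; rewrite !inE; transitivity true.
  by apply/existsP; exists j.
by apply/esym/existsP; exists i; rewrite lin_edge_sym.
Qed.

(* The two lemmas above are the conditions under which n_comp counts the
   connected components of the graph on lin_vertices. *)
Definition lin_components : nat := n_comp lin_edge lin_vertices.

End LinearRelationGraph.

(* Main.v *)
(** Each edge [{i, j}] of the linear relation graph comes from generators with
    [x_i u = x_j v], hence from a Koszul 1-cycle [u e_i - v e_j] with coefficients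
    in [I].  The product [w] of the cycles attached to a forest with [t] edges is a
    cycle with coefficients in [I^t], nonzero because the forest can be grown leaf
    by leaf, and [w] is the boundary of some [z] over [S].  Then [z] is a cycle
    modulo [I^t] in homological degree [t + 1].  It is not a boundary modulo [I^t]:
    otherwise [w] would have coefficients in [m I^t], whereas some coefficient of
    [w] is, up to sign, a monomial of the least degree occurring in [I^t].
    A regular sequence of length [l] in [m] kills the Koszul homology of [S/I^t]
    in degrees above [n - l], so [l <= n - t - 1]. *)

Require Import Defs.
From HB Require Import structures.
From mathcomp Require Import all_boot all_order all_algebra.
From mathcomp Require Import boolp classical_sets.
From mathcomp Require Import mpoly ring zify.

Set Implicit Arguments.
Unset Strict Implicit.
Unset Printing Implicit Defensive.

Import GRing.Theory.
Local Open Scope classical_set_scope.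
Local Open Scope ring_scope.

(** Splitting off one index removes a row and a column, which cancel by antisymmetry. The diagonal
    is a separate hypothesis because antisymmetry does not kill it in characteristic 2. *)
Lemma big_alternating0 (V : zmodType) (T : Type) (r : seq T) (F : T -> T -> V) :
  (forall i, F i i = 0) -> (forall i j, F i j = - F j i) ->
  \sum_(i <- r) \sum_(j <- r) F i j = 0.
Proof.
move=> F0 FN; elim: r => [|a r IHr]; first by rewrite big_nil.
under eq_bigr => i _ do rewrite big_cons.
rewrite big_split /= !big_cons F0 add0r IHr addr0.
by rewrite -big_split big1 // => i _; rewrite [F a i]FN /= addrN.
Qed.

(** * Exterior algebra and the Koszul differential *)

Section Koszul.
Variables (R : comNzRingType) (n : nat).

(* The exterior algebra of R^n; [w A] is the coefficient of [w] at the
   increasing wedge product of the [e_a], [a \in A]. *)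
Local Notation exterior := {ffun {set 'I_n} -> R^o}.
Implicit Types (w : exterior) (A : {set 'I_n}) (i j : 'I_n).

Lemma exterior_scaleE (a : R) w A : (a *: w) A = a * w A.
Proof. by rewrite ffunE. Qed.

(** Parity of the number of transpositions that carry [e_i] from the front to its sorted place among
    the [e_a], [a] in [A]. *)
Definition ext_sign i A : bool := odd #|[set a in A | (a < i)%N]%SET|.

Lemma ext_signU1 i j A :
  j \notin A -> ext_sign i (j |: A)%SET = (j < i)%N (+) ext_sign i A.
Proof.
move=> jA; rewrite /ext_sign; have [ji|ji] := boolP (j < i)%N.
  rewrite (_ : finset _ = (j |: [set a in A | (a < i)%N])%SET).
    by rewrite cardsU1 inE (negbTE jA) oddD.
  by apply/finset.setP => a; rewrite !inE; case: (eqVneq a j) => [->|].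
congr (odd _); apply: eq_card => a; rewrite !inE.
by case: (eqVneq a j) => [->|//]; rewrite (negbTE ji) !andbF.
Qed.

Definition wedge i w : exterior :=
  [ffun A : {set 'I_n} =>
     if i \in A then (-1) ^+ ext_sign i (A :\ i)%SET * w (A :\ i)%SET else 0].

(** Interior product with the [i]-th coordinate form. *)
Definition contract i w : exterior :=
  [ffun A : {set 'I_n} => if i \in A then 0 else (-1) ^+ ext_sign i A * w (i |: A)%SET].

Lemma wedge_is_linear i : linear (wedge i).
Proof.
move=> a w w'; apply/ffunP => A; rewrite !(exterior_scaleE, ffunE).
by case: ifP => _; rewrite ?mulr0 ?addr0 // mulrDr mulrCA.
Qed.

HB.instance Definition _ i :=
  GRing.isLinear.Build R exterior exterior *:%R (wedge i) (wedge_is_linear i).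

Lemma contract_is_linear i : linear (contract i).
Proof.
move=> a w w'; apply/ffunP => A; rewrite !(exterior_scaleE, ffunE).
by case: ifP => _; rewrite ?mulr0 ?addr0 // mulrDr mulrCA.
Qed.

HB.instance Definition _ i :=
  GRing.isLinear.Build R exterior exterior *:%R (contract i) (contract_is_linear i).

(** The Clifford relation. For distinct [i] and [j] the two orders of operation differ by a sign
    because exactly one of [i < j] and [j < i] holds. *)
Lemma contract_wedge i j w :
  contract j (wedge i w) = w *+ (i == j) - wedge i (contract j w).
Proof.
apply/ffunP => A; rewrite !ffunE.
have [<-|ij] /= := eqVneq i j.
  rewrite mulr1n; have [iA|iA] := boolP (i \in A).
    by rewrite !inE eqxx mulrA -signr_addb addbb mul1r finset.setD1K // subrr.
  by rewrite finset.setU11 finset.setU1K // mulrA -signr_addb addbb mul1r subr0.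
rewrite !inE (negbTE ij) (eq_sym j) (negbTE ij) /= mulr0n ffunE add0r.
have [jA|jA] := boolP (j \in A); first by rewrite mulr0 if_same oppr0.
have [iA|iA] := boolP (i \in A); last by rewrite mulr0 oppr0.
have -> : ((j |: A) :\ i = j |: (A :\ i))%SET.
  apply/finset.setP => a; rewrite !inE.
  by case: (eqVneq a j) => [->|//]; rewrite eq_sym ij.
rewrite ext_signU1 ?inE ?(negbTE jA) ?andbF //.
rewrite -[in ext_sign j A](finset.setD1K iA) ext_signU1 ?finset.setD11 //.
rewrite !mulrA -mulNr -!signr_addb -signrN -addbT; congr ((-1) ^+ _ * _).
have : (i != j :> nat) by [].
by rewrite neq_ltn; case: ltngtP => //= _ _; do 2!case: ext_sign.
Qed.

Lemma contract_contract i j w :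
  contract i (contract j w) = - contract j (contract i w).
Proof.
have [<-|ij] := eqVneq i j.
  by apply/ffunP => A; rewrite !ffunE finset.setU11 mulr0 if_same oppr0.
apply/ffunP => A; rewrite !ffunE !inE (negbTE ij) (eq_sym j) (negbTE ij) /=.
have [iA|iA] := boolP (i \in A); first by rewrite mulr0 if_same oppr0.
have [jA|jA] := boolP (j \in A); first by rewrite mulr0 oppr0.
rewrite !ext_signU1 // finset.setUCA !mulrA -mulNr -!signr_addb -signrN -addbT.
congr ((-1) ^+ _ * _).
have : (i != j :> nat) by [].
by rewrite neq_ltn; case: ltngtP => //= _ _; do 2!case: ext_sign.
Qed.

Lemma contract_idem0 i w : contract i (contract i w) = 0.
Proof. by apply/ffunP => A; rewrite !ffunE finset.setU11 mulr0 if_same. Qed.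

Variable x : 'I_n -> R.

Definition koszul w : exterior := \sum_i x i *: contract i w.

Lemma koszul_is_linear : linear koszul.
Proof.
move=> a w w'; rewrite /koszul scaler_sumr -big_split; apply: eq_bigr => i _.
by rewrite linearP scalerDr !scalerA mulrC.
Qed.

HB.instance Definition _ :=
  GRing.isLinear.Build R exterior exterior *:%R koszul koszul_is_linear.

Lemma koszul_koszul w : koszul (koszul w) = 0.
Proof.
rewrite /koszul; under eq_bigr => i _ do rewrite linear_sum scaler_sumr.
apply: big_alternating0 => [i|i j]; first by rewrite linearZ /= contract_idem0 !scaler0.
by rewrite !linearZ /= contract_contract !scalerN !scalerA mulrC.
Qed.

Lemma koszul_wedge i w : koszul (wedge i w) = x i *: w - wedge i (koszul w).
Proof.
rewrite /koszul linear_sum; under eq_bigr => j _ do rewrite contract_wedge scalerBr.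
rewrite big_split /= (bigD1 i) //= eqxx mulr1n big1 ?addr0 => [|j ji].
  by congr (_ + _); rewrite -sumrN; apply: eq_bigr => j _; rewrite [in RHS]linearZ.
by rewrite eq_sym (negbTE ji) scaler0.
Qed.

(** Wedging with the form of coefficients [a] is a homotopy between 0 and multiplication by the sum
    of the [a i * x i]. *)
Lemma koszul_homotopy (a : 'I_n -> R) w :
  koszul (\sum_i a i *: wedge i w) =
  (\sum_i a i * x i) *: w - \sum_i a i *: wedge i (koszul w).
Proof.
rewrite linear_sum scaler_suml -sumrB; apply: eq_bigr => i _.
by rewrite linearZ /= koszul_wedge scalerBr scalerA.
Qed.

(** * Koszul homology modulo a chain of ideals *)

Section Coefficients.
Variable J : set R.
Hypothesis J_ideal : is_ideal J.

Lemma ideal_sum (T : Type) (r : seq T) (F : T -> R) :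
  (forall k, J (F k)) -> J (\sum_(k <- r) F k).
Proof.
case: J_ideal => J0 JD _ JF.
by elim/big_ind: _.
Qed.

Lemma ideal_wedge i w : (forall A, J (w A)) -> forall A, J (wedge i w A).
Proof.
case: J_ideal => J0 _ JM Jw A; rewrite ffunE; case: ifP => _ //; exact: JM.
Qed.

Lemma ideal_koszul w : (forall A, J (w A)) -> forall A, J (koszul w A).
Proof.
case: J_ideal => J0 _ JM Jw A; rewrite sum_ffunE; apply: ideal_sum => i.
by rewrite !ffunE; apply: (JM); case: ifP => _ //; exact: JM.
Qed.

Lemma ideal_sub u v : J u -> J v -> J (u - v).
Proof. by case: J_ideal => _ JD JM Ju Jv; rewrite -mulN1r; apply/JD/JM. Qed.

End Coefficients.

(* With [h] the wedge product by the linear form attached to [f k], one has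
   [f k z = d (h z) + h (d z)]: a cycle [z] modulo [J k] gives a cycle [h z]
   modulo [J k.+1], which is a boundary by induction; dividing by [f k] makes [z]
   a boundary modulo [J k]. *)
Lemma koszul_vanishing (l : nat) (J : nat -> set R) (f : nat -> R)
    (a : nat -> 'I_n -> R)
    (J_ideal : forall k, is_ideal (J k))
    (Jsub : forall k u, (k < l)%N -> J k u -> J k.+1 u)
    (Jgen : forall k g, (k < l)%N -> J k.+1 (f k * g))
    (Jsucc : forall k u, (k < l)%N -> J k.+1 u -> exists g, J k (u - f k * g))
    (reg : forall k u, (k < l)%N -> J k (f k * u) -> J k u)
    (fx : forall k, (k < l)%N -> f k = \sum_i a k i * x i) (m p : nat) (z : exterior) :
  (m <= l)%N -> (n < p + m)%N -> (forall A, z A != 0 -> (p <= #|A|)%N) ->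
  (forall A, J (l - m)%N (koszul z A)) ->
  exists y, forall A, J (l - m)%N ((z - koszul y) A).
Proof.
elim: m p z => [|m IHm] p z ml pn zp Jz.
  (* With no element left, [p > n], and no subset of the [n] indices is that large, so [z = 0]. *)
  exists 0 => A; rewrite linear0 subr0.
  have [_ _ _] := J_ideal 0%N; case: (J_ideal (l - 0)%N) => J0 _ _.
  suff /eqP -> : z A == 0 by [].
  apply: contraTT pn => /zp pA; rewrite addn0 -leqNgt.
  by rewrite (leq_trans pA) // (leq_trans (max_card _)) // card_ord.
set k := (l - m.+1)%N in Jz *.
have kl : (k < l)%N by rewrite /k ltn_subLR // addSn ltnS leq_addl.
have lm : (l - m)%N = k.+1 by rewrite /k subnSK.
set hz := \sum_i a k i *: wedge i z.
have khz : koszul hz = f k *: z - \sum_i a k i *: wedge i (koszul z).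
  by rewrite koszul_homotopy -fx.
have Jh A : J k ((\sum_i a k i *: wedge i (koszul z)) A).
  rewrite sum_ffunE; apply: ideal_sum => // i; rewrite ffunE.
  by case: (J_ideal k) => _ _; apply; apply: ideal_wedge.
have {}IH : exists y, forall A, J (l - m)%N ((hz - koszul y) A).
  apply: (IHm p.+1); [exact: ltnW | by rewrite addSnnS | |].
    move=> A; apply: contraNT; rewrite -ltnNge ltnS => Ap.
    rewrite sum_ffunE big1 // => i _; rewrite !(exterior_scaleE, ffunE).
    case: ifPn => [iA|_]; last by rewrite mulr0.
    have [->|/zp] := eqVneq (z (A :\ i)%SET) 0; first by rewrite !mulr0.
    by move: Ap; rewrite (cardsD1 i A) iA => Ap /(leq_trans Ap); rewrite ltnn.
  (* [hz] is a cycle modulo [J k.+1]: that ideal contains the multiples of [f k], and it contains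
     [J k], where the other term lies. *)
  move=> A; rewrite lm khz !(exterior_scaleE, ffunE).
  apply: ideal_sub => //; first exact: Jgen.
  exact: Jsub.
case: IH => y; rewrite lm => Jy.
have /choice[g Jg] : forall A, exists g, J k ((hz - koszul y) A - f k * g).
  by move=> A; apply: Jsucc.
(* Modulo [J k], [hz] is [koszul y + f k *: g']. Applying [koszul] shows that
   [f k *: (z - koszul g')] has coefficients in [J k], and [reg] cancels [f k]. *)
pose g' : exterior := [ffun A => g A]; exists g' => A; apply: reg => //.
have -> : f k * (z - koszul g') A = (\sum_i a k i *: wedge i (koszul z)) A
   + koszul (hz - koszul y - f k *: g') A.
  rewrite !linearB /= koszul_koszul subr0 khz linearZ /=.
  by rewrite !(exterior_scaleE, ffunE); ring.
case: (J_ideal k) => _ JD _; apply: JD => //.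
apply: ideal_koszul => // B; move: (Jg B); congr (J k _).
by rewrite !(exterior_scaleE, ffunE).
Qed.

End Koszul.

(** * Ideals and their powers *)

Section IdealFacts.
Variable R : comNzRingType.
Implicit Types (I J A : set R).

Lemma sub_ideal_gen A : A `<=` ideal_gen A.
Proof. by move=> a Aa J [_ AJ]; apply: AJ. Qed.

Lemma ideal_gen_min A J : is_ideal J -> A `<=` J -> ideal_gen A `<=` J.
Proof. by move=> J_ideal AJ a; apply. Qed.

Lemma ideal_gen_id J : is_ideal J -> ideal_gen J = J.
Proof.
move=> J_ideal; apply/seteqP; split; last exact: sub_ideal_gen.
exact: ideal_gen_min.
Qed.

(** The [b] with [a * b] in the next power form an ideal, so it suffices to treat products of [k]
    elements, to which [a] is prepended as a factor. *)
Lemma ideal_powS I k a b : I a -> ideal_pow I k b -> ideal_pow I k.+1 (a * b).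
Proof.
have [P0 PD PM] : is_ideal (ideal_pow I k.+1) := ideal_genP _.
move=> Ia Ib; apply: (Ib [set b | ideal_pow I k.+1 (a * b)]); split.
  split=> [|u v Iu Iv|u v Iv] /=; first by rewrite mulr0.
    by rewrite mulrDr; apply: PD.
  by rewrite mulrCA; apply: PM.
move=> _ [f If ->]; apply: sub_ideal_gen.
exists (fun j => if unlift ord0 j is Some i then f i else a).
  by move=> j; case: unlift.
rewrite big_ord_recl unlift_none; congr (_ * _).
by apply: eq_bigr => i _; rewrite liftK.
Qed.

End IdealFacts.

(** * Filtration of polynomials by least degree *)

Section Order.
Variables (K : fieldType) (n : nat).
Local Notation S := {mpoly K[n]}.
Implicit Types (p q : S) (I : set S).

(** The [N]-th power of the maximal ideal, described through coefficients so that degrees can be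
    compared directly. *)
Definition order_ge N : set S := [set p | forall m, (mdeg m < N)%N -> p@_m = 0].

Lemma order_geM N M p q : order_ge N p -> order_ge M q -> order_ge (N + M) (p * q).
Proof.
move=> pN qM m mNM; rewrite mcoeffM big1 // => -[k1 k2] /= /eqP mk.
have [/pN->|Nk] := ltnP (mdeg k1) N; first by rewrite mul0r.
rewrite qM ?mulr0 // -(ltn_add2l N); apply: leq_ltn_trans mNM.
by rewrite [in leqRHS]mk mdegD leq_add2r.
Qed.

Lemma order_ge_ideal N : is_ideal (order_ge N).
Proof.
split=> [m _|p q pN qN m mN|p q qN]; first by rewrite mcoeff0.
  by rewrite mcoeffD pN // qN // addr0.
by rewrite -[N]add0n; apply: order_geM.
Qed.

Lemma order_geX m : order_ge (mdeg m) 'X_[m].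
Proof.
by move=> m' mm'; rewrite mcoeffX; case: eqP mm' => // ->; rewrite ltnn.
Qed.

Lemma ideal_pow_order I d t : I `<=` order_ge d -> ideal_pow I t `<=` order_ge (t * d).
Proof.
move=> Id; apply: ideal_gen_min; first exact: order_ge_ideal.
move=> _ [f If ->]; elim: t f If => [|t IHt] f If //.
by rewrite big_ord_recl mulSn; apply: order_geM; [exact: Id | exact: IHt].
Qed.

Lemma mem_max_ideal p :
  max_ideal p -> exists a : 'I_n -> S, p = \sum_i a i * 'X_i.
Proof.
apply: (ideal_gen_min (J := [set p | exists a : 'I_n -> S, p = \sum_i a i * 'X_i])).
  split.
  - by exists (fun=> 0); rewrite big1 // => i _; rewrite mul0r.
  - move=> _ _ [a ->] [b ->]; exists (fun i => a i + b i).
    by rewrite -big_split; apply: eq_bigr => i _; rewrite mulrDl.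
  - move=> c _ [a ->]; exists (fun i => c * a i).
    by rewrite mulr_sumr; apply: eq_bigr => i _; rewrite mulrA.
move=> _ [i _ <-]; exists (fun j => (j == i)%:R).
rewrite (bigD1 i) //= eqxx mul1r big1 ?addr0 // => j /negbTE->.
by rewrite mul0r.
Qed.

End Order.

(** * Koszul cycles from forests in the linear relation graph *)

Section ForestCycle.
Variables (K : fieldType) (n : nat) (G : set 'X_{1..n}) (d : nat).
Hypothesis G_deg : forall u, G u -> mdeg u = d.
Local Notation S := {mpoly K[n]}.
Local Notation exterior := {ffun {set 'I_n} -> S^o}.
Local Notation X := (fun i : 'I_n => 'X_i : S).
Local Notation I := (@mon_ideal K n G).
Local Notation e := (lin_edge G).

Lemma wedge_neq0 i (w : exterior) (A : {set 'I_n}) :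
  wedge i w A != 0 -> i \in A /\ w (A :\ i)%SET != 0.
Proof.
rewrite ffunE; case: ifP => [iA|_]; last by rewrite eqxx.
by move=> nz; split=> //; apply: contra nz => /eqP->; rewrite mulr0.
Qed.

(** As [i] and [j] differ, [x_i u = x_j v] forces [x_j] to divide [u]; [m] is the quotient. *)
Lemma lin_edge_syzygy i j : e i j -> exists m : 'X_{1..n},
  [/\ i != j, G (U_(j) + m)%MM & G (U_(i) + m)%MM].
Proof.
case/andP=> ij /asboolP[u [v [Gu Gv uv]]].
have uj : (U_(j) <= u)%MM.
  apply/mnm_lepP => a; rewrite mnmE; case: (eqVneq j a) => [<-|//].
  move/mnmP: uv => /(_ j); rewrite !mnmDE !mnmE (negbTE ij) eqxx add0n => ->.
  exact: leq_addr.
exists (u - U_(j))%MM; split=> //; first by rewrite addmC submK.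
suff -> : (U_(i) + (u - U_(j)))%MM = v by [].
apply/eqP; rewrite -(eqm_add2l U_(j)%MM) addmC -addmA submK //.
by rewrite uv.
Qed.

(** Vertex sets that a forest grown from the component roots may have reached. *)
Definition visited (W : {set 'I_n}) : Prop :=
  (forall i, i \in W -> i \in lin_vertices G) /\
  (forall i, i \in lin_vertices G -> fingraph.root e i \in W).

(** With no edge leaving it, [W] would be a union of components; containing every root, it would be
    the whole vertex set. *)
Lemma visited_boundary W : visited W -> (#|W| < #|lin_vertices G|)%N ->
  exists i j, [/\ e i j, i \notin W & j \in W].
Proof.
move=> [WV rW] WltV; apply: contrapT => no_edge.
have closedW : fingraph.closed e W.
  apply: (intro_closed (lin_edge_connect_sym G)) => j i eji jW.
  apply: contrapT => /negP iW; apply: no_edge; exists i, j; split=> //.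
  by rewrite lin_edge_sym.
move: WltV; rewrite ltnNge => /negP[]; apply: subset_leq_card.
apply/fintype.subsetP => i iV.
by rewrite (closed_connect closedW (connect_root _ i)) rW.
Qed.

(* The product of the 1-cycles [u e_i - v e_j] over the edges of a forest grown
   one leaf at a time from the roots of the components: [W] is the set of
   vertices reached, so each new [e_i] is fresh and yields a coefficient that
   cannot cancel. *)
Lemma forest_cycle k : (k <= #|lin_vertices G| - lin_components G)%N ->
  exists (W : {set 'I_n}) (w : exterior),
  [/\ visited W, #|W| = (lin_components G + k)%N,
      (forall A : {set 'I_n}, w A != 0 -> A \subset W /\ (k <= #|A|)%N) &
   [/\ forall A, ideal_pow I k (w A),
      (exists A (b : bool) m, w A = (-1) ^+ b * 'X_[m] /\ mdeg m = (k * d)%N),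
      koszul X w = 0 &
      ((0 < k)%N -> exists2 z : exterior, w = koszul X z &
                    forall A : {set 'I_n}, z A != 0 -> (k < #|A|)%N)]].
Proof.
elim: k => [_|k IHk klt].
  (* The edgeless forest consists of one root per component, and its cycle is the unit of the
     exterior algebra. *)
  exists [set i in lin_vertices G | fingraph.root e i == i]%SET.
  exists [ffun A : {set 'I_n} => (A == finset.set0)%:R : S]; split.
  - split=> [i|i iV]; rewrite finset.in_set; first by case/andP.
    apply/andP; split.
      by rewrite -(closed_connect (@lin_vertices_closed _ G) (connect_root _ i)).
    exact/eqP/root_root/lin_edge_connect_sym.
  - rewrite addn0; apply: eq_card => i.
    by rewrite finset.in_set andbC.
  - move=> A; rewrite ffunE; have [->|_] := eqVneq A finset.set0; last by rewrite eqxx.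
    by rewrite finset.sub0set.
  split=> //.
  - move=> A; rewrite ffunE -[_%:R]mulr1.
    have [_ _] : is_ideal (ideal_pow I 0) := ideal_genP _; apply.
    by apply: sub_ideal_gen; exists (fun=> 1) => [[]//|]; rewrite big_ord0.
  - exists finset.set0, false, 0%MM.
    by rewrite ffunE eqxx mdeg0 mpolyX0 mul1r.
  - rewrite /koszul big1 // => i _; apply/ffunP => A.
    rewrite !(exterior_scaleE, ffunE).
    rewrite (_ : (i |: A)%SET == finset.set0 = false) ?mulr0 ?if_same ?mulr0 //.
    by apply/negbTE/set0Pn; exists i; rewrite finset.setU11.
have [|W [w [[WV rW] cardW suppw [Iw [A0 [b [m0 [wA0 degm0]]]] dw0 _]]]] := IHk.
  exact: ltnW.
have [||i [j [eij iW jW]]] := @visited_boundary W; first by [].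
  by rewrite cardW -ltn_subRL.
have [m [ij Gu Gv]] := lin_edge_syzygy eij.
(* [w'] is the product of the new edge's 1-cycle with [w]. Since [w] is a cycle, [w'] is the
   boundary of [z], a multiple of [e_i e_j w]. *)
pose w' : exterior := 'X_[U_(j) + m] *: wedge i w - 'X_[U_(i) + m] *: wedge j w.
pose z : exterior := - ('X_[m] *: wedge i (wedge j w)).
have w'E : w' = koszul X z.
  rewrite /z linearN linearZ /= koszul_wedge koszul_wedge dw0 linear0 subr0.
  rewrite (linearZ_LR (wedge i)) scalerBr opprB.
  by rewrite /w' !mpolyXD !(mulrC _ 'X_[m]) -!scalerA.
have w'A A : w' A = 'X_[U_(j) + m] * wedge i w A - 'X_[U_(i) + m] * wedge j w A.
  by rewrite !(exterior_scaleE, ffunE).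
have iV : i \in lin_vertices G by rewrite inE; apply/existsP; exists j.
have iw A : w A != 0 -> i \notin A.
  by case/suppw => /fintype.subsetP AW _; apply: contra iW => /AW.
exists (i |: W)%SET, w'; split.
- split=> [a|a /rW aW]; rewrite finset.in_setU1; last by rewrite aW orbT.
  by case/orP=> [/eqP->//|/WV].
- by rewrite cardsU1 iW cardW addnS.
- move=> A nz; have [wi0|/wedge_neq0[iA wA]] := eqVneq (wedge i w A) 0; last first.
    have [AW kA] := suppw _ wA; split; last by rewrite (cardsD1 i) iA.
    by rewrite -(finset.setD1K iA) finset.setUS.
  have [wj0|/wedge_neq0[jA wA]] := eqVneq (wedge j w A) 0.
    by move: nz; rewrite w'A wi0 wj0 !mulr0 subr0 eqxx.
  have [AW kA] := suppw _ wA; split; last by rewrite (cardsD1 j) jA.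
  rewrite -(finset.setD1K jA) finset.subUset finset.sub1set finset.in_setU1 jW orbT /=.
  by rewrite (fintype.subset_trans AW) // finset.subsetUr.
split.
- have X_I u : G u -> I 'X_[u] by move=> G_u; apply: sub_ideal_gen; exists u.
  have P_ideal : is_ideal (ideal_pow I k) := ideal_genP _.
  have P'_ideal : is_ideal (ideal_pow I k.+1) := ideal_genP _.
  move=> A; rewrite w'A; apply: (ideal_sub P'_ideal).
    exact: (@ideal_powS S I k _ _ (X_I _ Gu) (ideal_wedge P_ideal i Iw A)).
  exact: (@ideal_powS S I k _ _ (X_I _ Gv) (ideal_wedge P_ideal j Iw A)).
- have iA0 : i \notin A0.
    apply: iw; rewrite wA0; apply/eqP => /(congr1 (mcoeff m0)).
    rewrite mcoeff0 => /eqP; rewrite -[_ ^+ b](rmorph_sign (@mpolyC n K)) mul_mpolyC.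
    by rewrite mcoeffZ mcoeffX eqxx mulr1 signr_eq0.
  (* The term in [e_j] contributes nothing at [i |: A0]: removing [j] leaves a set containing [i],
     outside the support of [w]. Only the monomial from the [e_i] term remains. *)
  exists (i |: A0)%SET, (ext_sign i A0 (+) b), ((U_(j) + m) + m0)%MM; split.
    have wj0 : wedge j w (i |: A0)%SET = 0.
      apply/eqP; apply: contraTT isT => /wedge_neq0[_ /iw].
      by rewrite !inE ij eqxx.
    rewrite w'A wj0 mulr0 subr0 ffunE finset.setU11 finset.setU1K // wA0.
    by rewrite (mpolyXD _ (U_(j) + m)%MM) signr_addb; ring.
  by rewrite mdegD degm0 (G_deg Gu) mulSn.
- by rewrite w'E koszul_koszul.
- move=> _; exists z => // A nz.
  have /wedge_neq0[iA /wedge_neq0[jA wA]] : wedge i (wedge j w) A != 0.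
    apply: contra nz => /eqP wwA.
    by rewrite /z -scaleNr exterior_scaleE wwA mulr0.
  have [_ kA] := suppw _ wA.
  by rewrite (cardsD1 i) iA (cardsD1 j) jA !add1n !ltnS.
Qed.

End ForestCycle.

(** * Submodules generated by initial segments of a sequence *)

Section SeqSubmod.
Variables (R : comNzRingType) (M : lmodType R) (f : seq R).
Implicit Types (k : nat) (v : M).

Lemma seq_submod_takeP k v : (k <= size f)%N ->
  seq_submod (take k f) v <-> exists w : nat -> M, v = \sum_(0 <= i < k) f`_i *: w i.
Proof.
move=> kf; have E w : \sum_(0 <= i < size (take k f)) (take k f)`_i *: (w i : M) =
    \sum_(0 <= i < k) f`_i *: w i.
  by rewrite size_takel //; apply: eq_big_nat => i /andP[_ ik]; rewrite nth_take.
by split=> -[w ->]; exists w; rewrite E.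
Qed.

(** Peeling off the last element yields the relation between consecutive ideals that
    [koszul_vanishing] asks for. *)
Lemma seq_submod_takeSP k v : (k < size f)%N ->
  seq_submod (take k.+1 f) v <-> exists y, seq_submod (take k f) (v - f`_k *: y).
Proof.
move=> kf.
split=> [/(seq_submod_takeP _ kf)[w ->]|[y /(seq_submod_takeP _ (ltnW kf))[w vE]]].
  exists (w k); apply/(seq_submod_takeP _ (ltnW kf)); exists w.
  by rewrite big_nat_recr //= addrK.
apply/(seq_submod_takeP _ kf); exists (fun i => if i == k then y else w i).
rewrite big_nat_recr //= eqxx -[LHS](subrK (f`_k *: y)) vE; congr (_ + _).
by apply: eq_big_nat => i /andP[_ ik]; rewrite ltn_eqF.
Qed.

Lemma seq_submod0 : seq_submod f (0 : M).
Proof. by exists (fun=> 0); rewrite big1 // => i _; rewrite scaler0. Qed.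

Lemma seq_submodD v v' : seq_submod f v -> seq_submod f v' -> seq_submod f (v + v').
Proof.
move=> [w ->] [w' ->]; exists (fun i => w i + w' i).
by rewrite -big_split; apply: eq_bigr => i _; rewrite scalerDr.
Qed.

Lemma seq_submodZ a v : seq_submod f v -> seq_submod f (a *: v).
Proof.
move=> [w ->]; exists (fun i => a *: w i); rewrite scaler_sumr.
by apply: eq_bigr => i _; rewrite !scalerA mulrC.
Qed.

End SeqSubmod.

(** * Regular sequences on a cyclic module and Koszul homology *)

Section CyclicModule.
Variables (R : comNzRingType) (J : set R).
Hypothesis J_ideal : is_ideal J.
Local Notation M := (cyclic_mod J).
Local Open Scope quotient_scope.
Implicit Types (u v : R) (f : seq R).

Lemma pi_cyclicZ a u : \pi_M (a * u) = a *: \pi_M u.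
Proof. exact/esym/cyclic_scale_pi. Qed.

Lemma pi_cyclic0 : \pi_M (0 : R) = 0.
Proof. by rewrite -(mul0r 0) pi_cyclicZ scale0r. Qed.

Lemma pi_cyclicB u v : \pi_M (u - v) = \pi_M u - \pi_M v.
Proof. by rewrite pi_cyclicD -mulN1r pi_cyclicZ scaleN1r. Qed.

Lemma pi_cyclic_eq0 u : \pi_M u = 0 <-> J u.
Proof.
by rewrite -pi_cyclic0; split=> [/pi_cyclic_eq|Ju]; last apply/pi_cyclic_eq;
  rewrite subr0 ideal_gen_id.
Qed.

Lemma seq_submod_ideal f : is_ideal [set u | seq_submod f (\pi_M u)].
Proof.
split=> [|u v|a u] /=; first by rewrite pi_cyclic0; exact: seq_submod0.
  by rewrite pi_cyclicD; exact: seq_submodD.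
by rewrite pi_cyclicZ; exact: seq_submodZ.
Qed.

Lemma seq_submod_nil (v : M) : seq_submod [::] v <-> v = 0.
Proof.
split=> [[w ->]|->]; last exact: seq_submod0.
by rewrite big_nil.
Qed.

Lemma regular_seq_vanishing (n p : nat) (x : 'I_n -> R) f
    (z : {ffun {set 'I_n} -> R^o}) :
  {in f, forall u, exists a : 'I_n -> R, u = \sum_i a i * x i} ->
  regular_seq M f -> (n < p + size f)%N ->
  (forall A, z A != 0 -> (p <= #|A|)%N) -> (forall A, J (koszul x z A)) ->
  exists y, forall A, J ((z - koszul x y) A).
Proof.
move=> fx [freg _] pn zp Jz.
(* Pulling the submodules back to [R] gives the chain of ideals [J + (f_0, ..., f_(k-1))], starting
   at [J]. *)
pose Jk k := [set u | seq_submod (take k f) (\pi_M u)].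
have J0 : Jk 0%N = J.
  apply/seteqP; split=> u; rewrite /Jk /= take0 => ?.
    exact/pi_cyclic_eq0/seq_submod_nil.
  exact/seq_submod_nil/pi_cyclic_eq0.
have /choice[a fE] : forall k, exists a : 'I_n -> R,
    (k < size f)%N -> f`_k = \sum_i a i * x i.
  move=> k; have [kf|_] := ltnP k (size f); last by exists (fun=> 0).
  by have [a ->] := fx _ (mem_nth 0 kf); exists a.
have := @koszul_vanishing R n x (size f) Jk (nth 0 f) a _ _ _ _ _ fE (size f) p z.
rewrite subnn J0; apply=> //.
- by move=> k; exact: seq_submod_ideal.
- move=> k u kf ku; apply/seq_submod_takeSP => //; exists 0.
  by rewrite scaler0 subr0.
- move=> k g kf; apply/seq_submod_takeSP => //; exists (\pi_M g).
  by rewrite -pi_cyclicZ subrr; exact: seq_submod0.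
- move=> k u kf /seq_submod_takeSP[//|y]; exists (repr y).
  by rewrite /Jk /= pi_cyclicB pi_cyclicZ reprK.
- by move=> k u kf; rewrite /Jk /= pi_cyclicZ; exact: freg.
Qed.

End CyclicModule.

(** * The nonvanishing Koszul class and the depth bound *)

Lemma nonzero_koszul_class (K : fieldType) (n d t : nat) (G : set 'X_{1..n}) :
  (forall u, G u -> mdeg u = d) ->
  (0 < t <= #|lin_vertices G| - lin_components G)%N ->
  let J := ideal_pow (@mon_ideal K n G) t in
  let dK := koszul (fun i : 'I_n => 'X_i : {mpoly K[n]}) in
  exists z : {ffun {set 'I_n} -> {mpoly K[n]}^o},
             [/\ forall A, z A != 0 -> (t < #|A|)%N, forall A, J (dK z A) &
                forall y, ~ forall A, J ((z - dK y) A)].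
Proof.
move=> G_deg /andP[t0 tle] J dK.
have [W [w [_ _ _ [Iw [A [b [m [wA degm]]]] _ /(_ t0)[z wz zt]]]]] :=
  forest_cycle K G_deg tle.
exists z; split=> // [A'|y Jy]; first by rewrite /dK -wz; exact: Iw.
have I_order : mon_ideal G `<=` @order_ge K n d.
  apply: ideal_gen_min; first exact: order_ge_ideal.
  by move=> _ [u Gu <-]; rewrite -(G_deg u Gu); exact: order_geX.
(* If [z - dK y] had coefficients in [J], each of order at least [t * d], then [dK] would raise the
   order by one, yet [w A] is a signed monomial of degree exactly [t * d]. *)
have : @order_ge K n (t * d).+1 (w A).
  have -> : w = dK (z - dK y) by rewrite /dK linearB /= koszul_koszul subr0.
  rewrite sum_ffunE; apply: (ideal_sum (order_ge_ideal K n _)) => i.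
  rewrite exterior_scaleE -add1n; apply: order_geM.
    by rewrite -(mdeg1 i); exact: order_geX.
  rewrite ffunE; case: (order_ge_ideal K n (t * d)%N) => O0 _ OM.
  case: ifP => _; first exact: O0.
  apply: (OM); apply: (ideal_pow_order I_order); exact: Jy.
move/(_ m); rewrite degm ltnS leqnn wA => /(_ isT)/eqP.
rewrite -[_ ^+ b](rmorph_sign (@mpolyC n K)) mul_mpolyC.
by rewrite mcoeffZ mcoeffX eqxx mulr1 signr_eq0.
Qed.

Theorem theorem3p3 (K : fieldType) (n : nat) (I : set {mpoly K[n]})
    (G : set 'X_{1..n}) (r s : nat)
    (I_monomial : is_monomial_ideal I)
    (G_min : min_mon_gens I G)
    (single_degree : exists d : nat, forall u, G u -> mdeg u = d)
    (r_vertices : #|lin_vertices G| = r)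
    (s_components : lin_components G = s)
    (t : nat) (t_range : (1 <= t <= r - s)%N) :
  exists2 d : nat,
    is_depth (cyclic_mod (ideal_pow I t)) (@max_ideal K n) d
    & d%:Z <= n%:Z - t%:Z - 1.
Proof.
move: t_range; rewrite -r_vertices -s_components => t_range.
have [-> _] := G_min; have [d G_deg] := single_degree.
have [z [zt Jz z_nbd]] := nonzero_koszul_class K G_deg t_range.
set J := ideal_pow _ t in Jz z_nbd *.
have J_ideal : is_ideal J := ideal_genP _.
have bound (f : seq {mpoly K[n]}) :
    {in f, forall u, @max_ideal K n u} -> regular_seq (cyclic_mod J) f ->
    (size f + t + 1 <= n)%N.
  move=> fm freg; rewrite leqNgt; apply/negP => nlt.
  (* [z] lives in degrees at least [t + 1], so a longer regular sequence would make it a boundary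
     modulo [J]. *)
  have [u /fm||y /z_nbd//] :=
    regular_seq_vanishing J_ideal (x := fun i => 'X_i) (p := t.+1) _ freg _ zt Jz.
    exact: mem_max_ideal.
  by rewrite addSn addnC; move: nlt; rewrite addn1.
(* The quotient is nonzero: otherwise [J] would contain all coefficients of [z], making its class
   trivial. *)
have nilreg : regular_seq (cyclic_mod J) [::].
  split=> // M0; apply: (z_nbd 0) => A.
  by apply/(pi_cyclic_eq0 J_ideal)/seq_submod_nil; rewrite M0.
(* The depth exists as the largest length of a regular sequence, these lengths being bounded by
   [n]. *)
pose P l := `[< exists2 f : seq {mpoly K[n]}, {in f, forall u, @max_ideal K n u}
                  & regular_seq (cyclic_mod J) f /\ size f = l >].
have P0 : exists l, P l by exists 0%N; apply/asboolP; exists [::].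
have Pn l : P l -> (l <= n)%N.
  move=> /asboolP[f fm [freg <-]]; apply: leq_trans (bound f fm freg).
  by rewrite -addnA leq_addr.
have [l /asboolP Pl lmax] := ex_maxnP P0 Pn; exists l.
  by split=> // f fm freg; apply: lmax; apply/asboolP; exists f.
by case: Pl => f fm [freg <-]; have := bound f fm freg; lia.
Qed.
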